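(* Let $n>k\ge 1$ be integers with $nk$ even. If $G$ is a graph of order $n$ with $kn/2$ edges, then there exists a $k$-regular graph $R$ of order $n$ such that $$\bigl|\,\|R\|_*-\|G\|_*\,\bigr|\le \sqrt{2\,s(G)\,n}.$$
   Context: Graphs are finite, simple and undirected; the order of a graph is its number of vertices and its size is its number of edges. The energy $\|G\|_*$ of a graph $G$ is the sum of the absolute values of the eigenvalues of its adjacency matrix (counted with multiplicity). For a graph $G$ of order $n$ and size $m$, the degree deviation is $s(G)=\sum_{u\in V(G)}\left|d(u)-\frac{2m}{n}\right|$, where $d(u)$ is the degree of the vertex $u$. *)

(* Defs.v *)
From HB Require Import structures.
From mathcomp Require Import all_boot all_order all_algebra.
From mathcomp Require Import polyrcf complex.

Set Implicit Arguments.
Unset Strict Implicit.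
Unset Printing Implicit Defensive.

Import Order.TTheory GRing.Theory Num.Theory.
Local Open Scope ring_scope.

Record sgraph := SGraph {
  vertex :> finType;
  adj : rel vertex;
  adj_sym : symmetric adj;
  adj_irrefl : irreflexive adj }.

Definition edges (G : sgraph) : {set {set G}} :=
  [set [set p.1; p.2] | p : G * G & adj p.1 p.2].

Definition num_edges (G : sgraph) : nat := #|edges G|.

Definition deg (G : sgraph) (u : G) : nat := #|[set v | adj u v]|.

Definition regular (k : nat) (G : sgraph) : Prop := forall u : G, deg u = k.

Definition adjmx (R : nzRingType) (G : sgraph) : 'M[R]_#|G| :=
  \matrix_(i, j) (adj (enum_val i) (enum_val j))%:R.

(* [rootsR p] lists each root of p in R once, so every eigenvalue is weighted
   by its algebraic multiplicity.  Only eigenvalues in R are summed, but there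
   are no others: see [char_poly_adjmx_split] and [energyE]. *)
Definition energy (R : rcfType) (G : sgraph) : R :=
  let p := char_poly (adjmx R G) in
  \sum_(x <- rootsR p) `|x| *+ mup x p.

Definition degree_deviation (R : rcfType) (G : sgraph) : R :=
  \sum_(u : G) `|(deg u)%:R - 2 * (num_edges G)%:R / #|G|%:R|.

Lemma energyE (R : rcfType) (G : sgraph) (s : seq R) :
  char_poly (adjmx R G) = \prod_(x <- s) ('X - x%:P) ->
  energy R G = \sum_(x <- s) `|x|.
Proof.
rewrite /energy => ->; set p := \prod_(_ <- _) _.
have p0 : p != 0 by apply: monic_neq0; apply: monic_prod_XsubC.
have rs : perm_eq (rootsR p) (undup s).
  apply: uniq_perm (undup_uniq s) _; first exact: uniq_roots.
  move=> x; have := roots_on_rootsR p0 x; rewrite inE /= => <-.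
  by rewrite mem_undup root_prod_XsubC.
rewrite (perm_big _ rs) -[RHS](big_undup_iterop_count _ s xpredT); apply: eq_bigr => x _.
by rewrite /p mu_prod_XsubC.
Qed.

Lemma char_poly_conj (F : fieldType) n (P D : 'M[F]_n) : P \in unitmx ->
  char_poly (invmx P *m D *m P) = char_poly D.
Proof.
move=> Pu; rewrite /char_poly /char_poly_mx.
pose Q := map_mx polyC P.
have Qu : Q \in unitmx by rewrite map_unitmx.
have -> : 'X%:M - map_mx polyC (invmx P *m D *m P)
   = invmx Q *m ('X%:M - map_mx polyC D) *m Q.
  rewrite mulmxBr mulmxBl !map_mxM map_invmx -/Q; congr (_ - _).
  by rewrite scalar_mxC -mulmxA mulVmx // mulmx1.
by rewrite !det_mulmx mulrC mulrA -det_mulmx mulmxV // det1 mul1r.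
Qed.

Lemma char_poly_adjmx_split (R : rcfType) (G : sgraph) :
  {s : seq R | char_poly (adjmx R G) = \prod_(x <- s) ('X - x%:P)}.
Proof.
pose f := [the {rmorphism R -> complex R} of real_complex R].
pose A := map_mx f (adjmx R G).
have Ah : A \is hermsymmx.
  apply: realsym_hermsym.
    apply/is_hermitianmxP; rewrite expr0 scale1r map_mx_id //.
    by apply/matrixP=> i j; rewrite !mxE adj_sym.
  apply/mxOverP=> i j; rewrite !mxE; apply/complex_realP; by eexists.
have eA := orthomx_spectralP (hermitian_normalmx Ah).
have dr := mxOverP (hermitian_spectral_diag_real Ah).
exists [seq complex.Re (spectral_diag A 0 i) | i <- enum 'I_#|G|].
apply: (map_poly_inj f); rewrite map_char_poly -/A {1}eA.
rewrite char_poly_conj ?spectral_unit // rmorph_prod big_map big_enum /=.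
rewrite char_poly_trig ?diag_mx_is_trig //.
apply: eq_bigr => i _; rewrite mxE eqxx mulr1n rmorphB /= map_polyX map_polyC /=.
by rewrite RRe_real.
Qed.

(* Main.v *)
Require Import Defs.
From HB Require Import structures.
From mathcomp Require Import all_boot all_order all_algebra.
From mathcomp Require Import complex zify.

Set Implicit Arguments.
Unset Strict Implicit.
Unset Printing Implicit Defensive.

Import Order.TTheory GRing.Theory Num.Theory.
Local Open Scope ring_scope.

(** The proof combines an edge-shifting argument with the fact that the energy
is a trace norm.

Combinatorics. The degrees of G average to k. As long as G is not k-regular
there are u with d(u) > k and v with d(v) < k; since u has at least two more
neighbours than v, some w is adjacent to u, not adjacent to v and different
from v. Replacing the edge uw by vw ([shift_edge]) lowers the total excess
e = sum of max(d(x) - k, 0) by one and alters two pairs of vertices. After e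
shifts the graph is k-regular ([regularization_by_shifts]), on the same vertices, and
its adjacency matrix differs from that of G in at most 4e entries. Since the
total deficiency is also e, s(G) = 2e, so at most 2 s(G) entries differ.

Linear algebra. For a normal matrix A, the sum of the moduli of the
eigenvalues is the value at some unitary U of tr(A U)
([eigen_abs_sum_attained]) and bounds |tr(A U)| for every unitary U
([trace_unitary_le]). If U is optimal for A, the difference of these sums for
A and B is therefore at most |tr((A - B) U)|, which by Cauchy-Schwarz is at
most the product of the Frobenius norms of A - B and of U; the latter is
sqrt n ([eigen_abs_sum_lipschitz]). Applied to the two adjacency matrices,
viewed over the complex numbers so that the spectral theorem is available,
this bounds the energy gap by sqrt(n * 2 s(G)). *)

(** * Sums of moduli of eigenvalues of normal matrices *)

Section NormalMatrices.
Local Open Scope sesquilinear_scope.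

Definition eigen_abs_sum (C : numClosedFieldType) n (A : 'M[C]_n) : C :=
  \sum_i `|spectral_diag A 0 i|.

Lemma normal_spectral (C : numClosedFieldType) n (A : 'M[C]_n) :
  A \is normalmx ->
  A = (spectralmx A) ^t* *m diag_mx (spectral_diag A) *m spectralmx A.
Proof.
by move=> /orthomx_spectralP {1}->; rewrite invmx_unitary ?spectral_unitarymx.
Qed.

Lemma unitary_diag_mx (C : numClosedFieldType) n (d : 'rV[C]_n) :
  (forall i, `|d 0 i| = 1) -> diag_mx d \is unitarymx.
Proof.
move=> d1; apply/unitarymxP; rewrite tr_diag_mx map_diag_mx mulmx_diag.
by apply/matrixP=> i j; rewrite !mxE -normCK d1 expr1n.
Qed.

Lemma unitary_entry_le1 (C : numClosedFieldType) n (U : 'M[C]_n) i j :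
  U \is unitarymx -> `|U i j| <= 1.
Proof.
move=> /unitarymxP /matrixP /(_ i i); rewrite !mxE eqxx => UU.
rewrite -(@ler_pXn2r _ 2) ?nnegrE ?ler01 //.
rewrite expr1n -(mulr1n 1) -UU (bigD1 j) //= !mxE -normCK lerDl.
by apply: sumr_ge0 => l _; rewrite !mxE -normCK exprn_ge0.
Qed.

(** In an orthonormal eigenbasis of A, take for U the diagonal matrix of the
conjugate phases of the eigenvalues. *)
Lemma eigen_abs_sum_attained (C : numClosedFieldType) n (A : 'M[C]_n) :
  A \is normalmx ->
  exists2 U : 'M[C]_n, U \is unitarymx & \tr (A *m U) = eigen_abs_sum A.
Proof.
move=> An; set P := spectralmx A; set a := spectral_diag A.
have Pu : P \is unitarymx by apply: spectral_unitarymx.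
pose w : 'rV[C]_n := \row_i (if a 0 i == 0 then 1 else `|a 0 i| / a 0 i).
have w1 i : `|w 0 i| = 1.
  rewrite mxE; case: eqP => [_|/eqP a0]; first by rewrite normr1.
  by rewrite normf_div normr_id divff // normr_eq0.
exists (P ^t* *m diag_mx w *m P).
  by rewrite !mul_unitarymx ?trmxC_unitary ?unitary_diag_mx.
rewrite {1}(normal_spectral An) -/P -/a !mulmxA mulmxtVK // mxtrace_mulC.
rewrite !mulmxA (unitarymxP Pu) mul1mx mulmx_diag mxtrace_diag.
apply: eq_bigr => i _; rewrite !mxE -/a.
by case: eqP => [->|/eqP a0]; rewrite ?mulr1 ?normr0 // mulrC divfK.
Qed.

(** In an orthonormal eigenbasis of A, the trace is the sum of the eigenvalues
weighted by the diagonal entries of a unitary matrix, which have modulus at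
most 1. *)
Lemma trace_unitary_le (C : numClosedFieldType) n (A U : 'M[C]_n) :
  A \is normalmx -> U \is unitarymx -> `|\tr (A *m U)| <= eigen_abs_sum A.
Proof.
move=> An Uu; set P := spectralmx A; set a := spectral_diag A.
have Pu : P \is unitarymx by apply: spectral_unitarymx.
rewrite {1}(normal_spectral An) -/P -/a -!mulmxA mxtrace_mulC -!mulmxA.
have Vu : P *m (U *m P ^t*) \is unitarymx.
  by rewrite !mul_unitarymx ?trmxC_unitary.
apply: le_trans (ler_norm_sum _ _ _) _; apply: ler_sum => i _.
rewrite mul_diag_mx mxE normrM ler_piMr //; exact: unitary_entry_le1.
Qed.

(** The Frobenius inner product of matrices is the standard inner product of
their row-major vectorisations. *)
Lemma trace_CauchySchwarz (C : numClosedFieldType) n (A B : 'M[C]_n) :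
  `|\tr (A *m B ^t*)| ^+ 2 <= \tr (A *m A ^t*) * \tr (B *m B ^t*).
Proof.
have trE (X Y : 'M[C]_n) : dotmx (mxvec X) (mxvec Y) = \tr (X *m Y ^t*).
  rewrite dotmxE mxE (reindex _ (curry_mxvec_bij n n)) /=.
  under [RHS]eq_bigr do rewrite mxE.
  by rewrite pair_bigA; apply: eq_bigr => -[i j] _; rewrite !mxE !mxvecE.
by rewrite -!trE; case: (CauchySchwarz (@dotmx C (n * n)) (mxvec A) (mxvec B)).
Qed.

(** The sum of moduli is the maximum of the linear functionals tr(_ U) over the
unitary U, and each such U has Frobenius norm sqrt n. *)
Lemma eigen_abs_sum_lipschitz (C : numClosedFieldType) n (A B : 'M[C]_n) :
  A \is normalmx -> B \is normalmx ->
  `|eigen_abs_sum A - eigen_abs_sum B| ^+ 2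
    <= n%:R * \sum_i \sum_j `|A i j - B i j| ^+ 2.
Proof.
have rE (X : 'M[C]_n) : eigen_abs_sum X \is Num.real.
  by rewrite ger0_real ?sumr_ge0.
wlog leBA : A B / eigen_abs_sum B <= eigen_abs_sum A.
  move=> IH An Bn.
  case/orP: (real_leVge (rE A) (rE B)) => le; last exact: IH.
  rewrite distrC; under eq_bigr do under eq_bigr do rewrite distrC.
  exact: IH.
move=> An Bn; have [U Uu UA] := eigen_abs_sum_attained An.
have leD : `|eigen_abs_sum A - eigen_abs_sum B| <= `|\tr ((A - B) *m U)|.
  rewrite mulmxBl raddfB /= UA.
  apply: le_trans (lerB_dist _ _).
  rewrite ger0_norm ?subr_ge0 // [X in _ <= X - _]ger0_norm ?sumr_ge0 //.
  by rewrite lerB // trace_unitary_le.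
apply: le_trans (_ : `|\tr ((A - B) *m U)| ^+ 2 <= _).
  by rewrite ler_pXn2r ?nnegrE.
(* The second factor of the bound is tr (U ^t* U), the size of the matrices. *)
rewrite -[in leLHS](trmxCK U); apply: le_trans (trace_CauchySchwarz _ _) _.
have /unitarymxP -> : U ^t* \is unitarymx by rewrite trmxC_unitary.
rewrite mxtrace1 mulrC; suff -> : \tr ((A - B) *m (A - B) ^t*) =
  \sum_i \sum_j `|A i j - B i j| ^+ 2 by [].
apply: eq_bigr => i _; rewrite mxE; apply: eq_bigr => j _.
by rewrite !mxE normCK.
Qed.

End NormalMatrices.

(** * Energies of graphs on the same vertices *)

Lemma normr_real_complex (R : rcfType) (x : R) :
  `|real_complex R x| = real_complex R `|x|.
Proof. by rewrite normc_def /= expr0n addr0 sqrtr_sqr. Qed.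

Lemma adjmx_normal (R : rcfType) (G : sgraph) :
  map_mx (real_complex R) (adjmx R G) \is normalmx.
Proof.
apply: hermitian_normalmx; apply: realsym_hermsym.
  apply/is_hermitianmxP; rewrite expr0 scale1r map_mx_id //.
  by apply/matrixP=> i j; rewrite !mxE adj_sym.
by apply/mxOverP=> i j; rewrite !mxE; apply/complex_realP; eexists.
Qed.

(** Both sides are read off a factorisation of the characteristic polynomial
into linear factors, and such a factorisation is unique up to order. *)
Lemma energy_spectral (R : rcfType) (G : sgraph) :
  real_complex R (energy R G) =
    eigen_abs_sum (map_mx (real_complex R) (adjmx R G)).
Proof.
set A := map_mx _ _.
have [s sE] := char_poly_adjmx_split R G.
have AE : char_poly A = \prod_(x <- map (real_complex R) s) ('X - x%:P).
  by rewrite -map_char_poly sE map_prod_XsubC big_map.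
have AE' : char_poly A =
    \prod_(x <- [seq spectral_diag A 0 i | i : 'I__]) ('X - x%:P).
  have eA := orthomx_spectralP (adjmx_normal R G); rewrite -/A in eA.
  rewrite {1}eA char_poly_conj ?spectral_unit //.
  rewrite char_poly_trig ?diag_mx_is_trig // big_map big_enum /=.
  by apply: eq_bigr => i _; rewrite mxE eqxx mulr1n.
have pE : perm_eq (map (real_complex R) s) [seq spectral_diag A 0 i | i : 'I__].
  by apply: prod_XsubC_eq; rewrite -AE AE'.
rewrite (energyE sE) /eigen_abs_sum -big_enum /=.
rewrite -(big_map (fun i => spectral_diag A 0 i) xpredT (fun x => `|x|)).
rewrite -(perm_big _ pE) big_map rmorph_sum; apply: eq_bigr => x _ /=.
by rewrite normr_real_complex.
Qed.

(** Ordered pairs, so that this set counts the differing entries of the two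
adjacency matrices. *)
Definition mismatches (T : finType) (a b : rel T) : {set T * T} :=
  [set p | a p.1 p.2 != b p.1 p.2].

(** The entries of the adjacency matrices are 0 or 1, so the squared Frobenius
distance of the matrices is the number of mismatches. *)
Lemma energy_mismatches (R : rcfType) (G : sgraph) (b : rel G)
    (sb : symmetric b) (ib : irreflexive b) :
  (energy R (SGraph sb ib) - energy R G) ^+ 2
    <= (#|G| * #|mismatches (@adj G) b|)%:R.
Proof.
set H := SGraph sb ib; pose f := real_complex R.
have : `|f (energy R H) - f (energy R G)| ^+ 2
    <= #|G|%:R * \sum_i \sum_j `|f (adjmx R H i j) - f (adjmx R G i j)| ^+ 2.
  have := eigen_abs_sum_lipschitz (adjmx_normal R H) (adjmx_normal R G).
  rewrite /f !energy_spectral => /le_trans; apply.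
  rewrite ler_wpM2l ?ler0n //; apply: ler_sum => i _; apply: ler_sum => j _.
  by rewrite !mxE.
rewrite -rmorphB normr_real_complex -rmorphXn real_normK ?num_real // => lip.
have lef x y : f x <= f y -> x <= y by rewrite lecR.
apply: lef; apply: le_trans lip _; rewrite /f rmorph_nat natrM.
rewrite ler_wpM2l ?ler0n // -sum1_card natr_sum pair_bigA /=.
rewrite [leLHS](reindex (fun p : G * G => (enum_rank p.1, enum_rank p.2))) /=;
  last first.
  by exists (fun p => (enum_val p.1, enum_val p.2)) => -[x y] _ /=;
    rewrite ?enum_rankK ?enum_valK.
rewrite [leRHS]big_mkcond; apply: ler_sum => -[x y] _.
rewrite !mxE !enum_rankK inE /=.
by case: (b x y) (adj x y) => [] []; rewrite /= ?subrr ?subr0 ?sub0r ?normrN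
  ?normr0 ?normr1 ?expr0n ?expr1n.
Qed.

(** * Making a graph regular *)

Local Open Scope nat_scope.

Definition rel_deg (T : finType) (a : rel T) (u : T) : nat :=
  #|[set v | a u v]|.

Lemma card_mismatches_trans (T : finType) (a b c : rel T) :
  #|mismatches a c| <= #|mismatches a b| + #|mismatches b c|.
Proof.
apply: leq_trans (leq_card_setU _ _); apply/subset_leq_card/subsetP => p.
by rewrite !inE; case: (a _ _) (b _ _) (c _ _) => [] [] [].
Qed.

(** Moving the edge uw to vw for a common third vertex w leaves d(w) unchanged.
The degree equation is written additively to avoid truncated subtraction. *)
Lemma shift_edge (T : finType) (a : rel T) (u v : T) :
    symmetric a -> irreflexive a -> (rel_deg a v).+1 < rel_deg a u ->
  exists b : rel T, [/\ symmetric b, irreflexive b,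
    forall x, rel_deg b x + (x == u) = rel_deg a x + (x == v)
    & #|mismatches a b| <= 4].
Proof.
move=> sa ia dvu.
(* Pigeonhole: u has at least two more neighbours than v. *)
have [w] : exists w, w \in [set y | a u y] :\: (v |: [set y | a v y]).
  apply/set0Pn; rewrite setD_eq0; apply/negP => /subset_leq_card.
  apply/negP; rewrite -ltnNge; apply: leq_ltn_trans dvu.
  by rewrite cardsU1 -add1n leq_add2r leq_b1.
rewrite !inE negb_or => /andP[/andP[wv avw] auw].
have uv : u != v by apply: contraTneq dvu => ->; rewrite -leqNgt leqW.
have wu : w != u by apply: contraTneq auw => ->; rewrite ia.
have awu : a w u by rewrite sa.
have awv : a w v = false by rewrite sa; apply: negbTE.
(* Flipping the adjacency of the pairs uw and vw moves the edge uw to vw. *)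
pose c x y := (x == w) && ((y == u) || (y == v)).
exists (fun x y => a x y (+) (c x y || c y x)).
split=> [x y|x|x|]; rewrite ?[c y x || _]orbC 1?sa //.
- rewrite ia orbb /c; case: eqP => //= ->.
  by rewrite (negbTE wu) (negbTE wv).
- rewrite /rel_deg.
  have [->|xu] := eqVneq x u.
    rewrite (negbTE uv) addn0 (cardsD1 w [set y | a u y]) inE auw addnC.
    congr (_ + #|pred_of_set _|); apply/setP=> y.
    rewrite !inE /c eqxx /= [u == w]eq_sym (negbTE wu) /= andbT.
    by case: eqP => [->|_]; rewrite ?auw ?addbF.
  have [->|xv] := eqVneq x v.
    rewrite addn0 addn1; transitivity #|w |: [set y | a v y]|; last first.
      by rewrite cardsU1 inE avw.
    congr #|pred_of_set _|; apply/setP=> y.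
    rewrite !inE /c eqxx orbT /= [v == w]eq_sym (negbTE wv) /= andbT.
    by case: eqP => [->|_]; rewrite ?(negbTE avw) ?addbF.
  rewrite !addn0; have [->|xw] := eqVneq x w.
    rewrite [RHS](cardsD1 u) inE awu.
    transitivity #|v |: ([set y | a w y] :\ u)|; last first.
      by rewrite cardsU1 !inE awv andbF.
    congr #|pred_of_set _|; apply/setP=> y.
    rewrite !inE /c eqxx /= [w == u](negbTE wu) (negbTE wv) andbF orbF.
    case: (eqVneq y v) => [->|yv]; first by rewrite orbT awv.
    by case: (eqVneq y u) => [->|yu] /=; rewrite ?awu ?addbF.
  congr #|pred_of_set _|; apply/setP=> y.
  by rewrite !inE /c (negbTE xu) (negbTE xv) (negbTE xw) andbF addbF.
- apply: leq_trans (card_size [:: (w, u); (w, v); (u, w); (v, w)]).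
  apply/subset_leq_card/subsetP => -[x y].
  rewrite !inE /= !xpair_eqE.
  have [cxy _|] := boolP (c x y || c y x); last by rewrite addbF eqxx.
  by case/orP: cxy => /andP[/eqP -> /orP[]/eqP ->]; rewrite !eqxx ?orbT.
Qed.

(** Asking for equal total excess and deficiency is a way of saying that the
degrees average to k; in this form both quantities drop by one at each shift,
which makes the induction go through. *)
Lemma regularization_by_shifts (T : finType) (k e : nat) (a : rel T) :
    symmetric a -> irreflexive a ->
    \sum_u (rel_deg a u - k) = e -> \sum_u (k - rel_deg a u) = e ->
  exists b : rel T, [/\ symmetric b, irreflexive b,
    forall u, rel_deg b u = k & #|mismatches a b| <= 4 * e].
Proof.
elim: e a => [|e IH] a sa ia.
  move=> /eqP; rewrite sum_nat_eq0 => /forallP ge /eqP.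
  rewrite sum_nat_eq0 => /forallP le; exists a; split=> // [u|].
    by apply/eqP; rewrite eqn_leq -!subn_eq0; apply/andP; split;
      [apply: ge | apply: le].
  by rewrite leqn0 cards_eq0; apply/eqP/setP => p; rewrite !inE eqxx.
move=> exc def.
have /existsP[u du] : [exists u, k < rel_deg a u].
  apply: contraT; rewrite negb_exists => /forallP le.
  by move: exc; rewrite big1 // => u _; apply/eqP; rewrite subn_eq0 leqNgt le.
have /existsP[v dv] : [exists v, rel_deg a v < k].
  apply: contraT; rewrite negb_exists => /forallP ge.
  by move: def; rewrite big1 // => v _; apply/eqP; rewrite subn_eq0 leqNgt ge.
have [b [sb ib db ab]] := shift_edge sa ia (leq_ltn_trans dv du).
have sum1 z : \sum_(x : T) (x == z : nat) = 1.
  by rewrite (bigD1 z) //= eqxx big1 // => x /negbTE ->.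
have uv : u != v by apply: contraTneq dv => <-; rewrite -leqNgt ltnW.
have excb : \sum_x (rel_deg b x - k) = e.
  apply/eqP; rewrite -eqSS -exc -addn1 -(sum1 u) -big_split /=; apply/eqP.
  apply: eq_bigr => x _; move: (db x).
  have [->|_] := eqVneq x u; first by rewrite (negbTE uv) /=; lia.
  by have [->|_] := eqVneq x v => /=; lia.
have defb : \sum_x (k - rel_deg b x) = e.
  apply/eqP; rewrite -eqSS -def -addn1 -(sum1 v) -big_split /=; apply/eqP.
  apply: eq_bigr => x _; move: (db x).
  have [->|_] := eqVneq x u; first by rewrite (negbTE uv) /=; lia.
  by have [->|_] := eqVneq x v => /=; lia.
have [c [sc ic dc bc]] := IH b sb ib excb defb.
exists c; split=> //; apply: leq_trans (card_mismatches_trans a b c) _.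
by rewrite mulnS leq_add.
Qed.

(** Each edge is the unordered pair underlying exactly two adjacent ordered
pairs. *)
Lemma handshake (G : sgraph) : \sum_(u : G) deg u = 2 * num_edges G.
Proof.
pose P := [set p : G * G | adj p.1 p.2].
pose f (p : G * G) := [set p.1; p.2].
have -> : \sum_(u : G) deg u = #|P|.
  rewrite -sum1_card (eq_bigl (fun p : G * G => adj p.1 p.2)); last first.
    by move=> p; rewrite inE.
  rewrite -(pair_big_dep xpredT (fun x y => adj x y) (fun _ _ => 1)) /=.
  by apply: eq_bigr => u _; rewrite sum1dep_card.
rewrite -sum1_card (partition_big_imset f) /= mulnC -sum_nat_const.
have -> : edges G = f @: P by [].
apply: eq_bigr => _ /imsetP[[x y] /[!inE] /= xy ->].
have nxy : x != y by apply: contraTneq xy => ->; rewrite adj_irrefl.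
rewrite sum1dep_card (_ : [set _ | _] = [set (x, y); (y, x)]).
  by rewrite cards2 xpair_eqE negb_and nxy.
apply/setP=> -[z t]; rewrite !inE !xpair_eqE /f /=.
apply/andP/orP => [[zt /eqP/setP ezt]|].
  have nzt : z != t by apply: contraTneq zt => ->; rewrite adj_irrefl.
  have := ezt z; have := ezt t; rewrite !inE !eqxx orbT /=.
  move=> /esym/orP[]/eqP et /esym/orP[]/eqP ez; move: nzt;
    by rewrite ez et ?eqxx //; auto.
by case=> /andP[/eqP -> /eqP ->]; [rewrite xy | rewrite adj_sym xy setUC].
Qed.

Local Open Scope ring_scope.

Theorem proposition8 (R : rcfType) (n k : nat) (hk : (1 <= k)%N)
    (hkn : (k < n)%N) (heven : ~~ odd (n * k)) (G : sgraph)
    (hG : #|G| = n) (hm : num_edges G = (k * n)./2) :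
  exists H : sgraph,
    [/\ #|H| = n,
        regular k H &
        `|energy R H - energy R G|
          <= Num.sqrt (2 * degree_deviation R G * n%:R)].
Proof.
have m2 : (2 * num_edges G = n * k)%N.
  by rewrite hm mulnC muln2 even_halfK mulnC // mulnC.
have avg : 2 * (num_edges G)%:R / #|G|%:R = k%:R :> R.
  have n0 : n%:R != 0 :> R by rewrite pnatr_eq0 -lt0n (leq_trans _ hkn).
  by rewrite -natrM m2 hG natrM mulrC mulKf.
pose e := (\sum_(u : G) (deg u - k))%N.
(* The degrees have mean k, so total excess and total deficiency agree. *)
have def : (\sum_(u : G) (k - deg u))%N = e.
  apply/eqP; rewrite -(eqn_add2l (n * k)) -{1}m2 -handshake -big_split /=.
  rewrite -hG -sum_nat_const -big_split /=; apply/eqP.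
  by apply: eq_bigr => u _; lia.
have devE : degree_deviation R G = (2 * e)%:R.
  rewrite mul2n -addnn -{2}def -big_split natr_sum; apply: eq_bigr => u _.
  rewrite avg /=; have [le|/ltnW le] := leqP (deg u) k.
    by rewrite distrC -natrB // normr_nat (eqP le).
  by rewrite -natrB // normr_nat (eqP le) addn0.
have [b [sb ib db ab]] :=
  regularization_by_shifts (@adj_sym G) (@adj_irrefl G) (erefl e) def.
exists (SGraph sb ib); split=> //.
rewrite -sqrtr_sqr ler_wsqrtr //.
apply: le_trans (energy_mismatches R sb ib) _.
rewrite devE -!natrM ler_nat hG [leqRHS]mulnC leq_mul2l; apply/orP; right.
by apply: leq_trans ab _; rewrite mulnA.
Qed.
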